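(* A subspace $U\subseteq V=H\otimes E$ is real if and only if, with respect to a symplectic basis $(h_1,h_2)$ of $H$, one has $U=U^{F,T}$ where the linear map $T:F=E_1=p_1(U)\to p_2(U)$ is an isomorphism such that $TW\nsubseteq W$ for every non trivial (nonzero) subspace $W\subseteq F\cap TF$. The (real) subspace $U=U^{F,T}$ is non degenerate if and only if $F$ is $g_F$-non degenerate. Let $E_2=TE_1$. A non degenerate real subspace $U$ is totally real if and only if $$\omega^E|_{E_1}=\omega^E|_{E_2}\equiv0\quad\text{and}\quad T|_{E_1}\text{ is }\omega^E\text{-skew-symmetric, i.e. }\omega^E(Te,e')=-\omega^E(e,Te')\ \ \forall e,e'\in E_1,$$ which implies $E_1\cap E_2=\{0\}$.
   Context: $H$ is a real vector space of dimension $2$ with symplectic form $\omega^H$, $E$ a real vector space of dimension $2n$ with symplectic form $\omega^E$; $V=H\otimes E$ with $\widetilde Q=\mathfrak{sl}(H)\otimes\mathrm{Id}\subset\mathrm{End}(V)$ and $g=\omega^H\otimes\omega^E$, i.e. $g(h\otimes e,h'\otimes e')=\omega^H(h,h')\omega^E(e,e')$. A symplectic basis $(h_1,h_2)$ of $H$ is one with $\omega^H(h_1,h_2)=1$. Given it, each $X\in V$ is uniquely $X=h_1\otimes e+h_2\otimes e'$, and $p_1(X)=e$, $p_2(X)=e'$. For a symplectic basis $(h_1,h_2)$, a subspace $F\subseteq E$ and a linear map $T:F\to E$, $U^{F,T}=\{h_1\otimes f+h_2\otimes Tf: f\in F\}$. With $\phi(f)=h_1\otimes f+h_2\otimes Tf$,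 $g_F=\phi^*(g|_U)$ is the pulled-back symmetric form on $F$. A subspace $U\subseteq V$ is real if $AU\cap U=\{0\}$ for all $A\in\widetilde Q$. $U$ is non degenerate if $g|_U$ is non degenerate. An admissible basis of $\widetilde Q$ is a basis $(I,J,K)$ of pairwise anticommuting endomorphisms with $-I^2=J^2=K^2=\mathrm{Id}$, $IJ=K$. A non degenerate real subspace $U$ is totally real if for one (hence any) admissible basis $(I,J,K)$ of $\widetilde Q$ one has $IU\perp U$, $JU\perp U$, $KU\perp U$ with respect to $g$. *)

(* Defs.v *)
From HB Require Import structures.
From mathcomp Require Import all_boot all_order all_algebra.

Set Implicit Arguments.
Unset Strict Implicit.
Unset Printing Implicit Defensive.

Import GRing.Theory passmx.
Local Open Scope ring_scope.

(* H (x) E is realised by matrices of coordinates in the library bases of H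
   and E; [tens_lift_tens] and [tens_lfunP] are its universal property. *)
Section TensorProduct.
Variable F : fieldType.

Definition tensor (H E : vectType F) : Type := 'M[F]_(\dim {:H}, \dim {:E}).

HB.instance Definition _ (H E : vectType F) :=
  Vector.copy (tensor H E) 'M[F]_(\dim {:H}, \dim {:E}).

Variables (H E : vectType F).

Definition tens (h : H) (e : E) : tensor H E :=
  \matrix_(i, j) (coord (vbasis {:H}) i h * coord (vbasis {:E}) j e).

Definition tens_lift_fun (W : vectType F) (b : H -> E -> W)
    (X : tensor H E) : W :=
  \sum_i \sum_j (X : 'M_(_, _)) i j *: b (vbasis {:H})`_i (vbasis {:E})`_j.

Lemma tens_lift_fun_linear (W : vectType F) (b : H -> E -> W) :
  linear (tens_lift_fun b).
Proof.
move=> a X Y; rewrite /tens_lift_fun scaler_sumr -big_split /=.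
apply: eq_bigr => i _; rewrite scaler_sumr -big_split /=.
by apply: eq_bigr => j _; rewrite !mxE scalerDl scalerA.
Qed.

HB.instance Definition _ (W : vectType F) (b : H -> E -> W) :=
  GRing.isLinear.Build F (tensor H E) W *:%R (tens_lift_fun b)
    (tens_lift_fun_linear b).

Definition tens_lift (W : vectType F) (b : H -> E -> W) :
  'Hom(tensor H E, W) := linfun (tens_lift_fun b).

Lemma tens_bilinear : bilinear_for *:%R *:%R tens.
Proof.
split=> u a x y; apply/matrixP=> i j.
  by rewrite !mxE linearP /= mulrDl mulrA.
by rewrite !mxE linearP /= mulrDr mulrCA.
Qed.

HB.instance Definition _ :=
  bilinear_isBilinear.Build F H E (tensor H E) *:%R *:%R tens tens_bilinear.

Lemma tens_lift_bilinear (W : vectType F) (b : {bilinear H -> E -> W}) h e :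
  tens_lift b (tens h e) = b h e.
Proof.
rewrite lfunE /= /tens_lift_fun.
rewrite [in RHS](coord_vbasis (memvf h)) linear_sumlz; apply: eq_bigr => i _.
rewrite [in RHS](coord_vbasis (memvf e)) linear_sumr; apply: eq_bigr => j _.
by rewrite mxE linearZl_LR linearZr_LR /= scalerA.
Qed.

Lemma tens_lift_tens (W : vectType F) (b : H -> E -> W) h e :
  bilinear_for *:%R *:%R b -> tens_lift b (tens h e) = b h e.
Proof.
move=> bil_b.
pose B : {bilinear H -> E -> W} :=
  HB.pack b (bilinear_isBilinear.Build F H E W *:%R *:%R b bil_b).
exact: (tens_lift_bilinear B).
Qed.

Lemma tens_vbasis (i : 'I_(\dim {:H})) (j : 'I_(\dim {:E})) :
  tens (vbasis {:H})`_i (vbasis {:E})`_j = (delta_mx i j : 'M_(_, _)).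
Proof.
apply/matrixP=> k l; rewrite !mxE !coord_free ?(basis_free (vbasisP _)) //.
by rewrite -natrM mulnb (eq_sym i) (eq_sym j).
Qed.

Lemma tens_span (X : tensor H E) :
  X = \sum_i \sum_j
    (X : 'M_(_, _)) i j *: tens (vbasis {:H})`_i (vbasis {:E})`_j.
Proof.
rewrite {1}[X]matrix_sum_delta; apply: eq_bigr => i _; apply: eq_bigr => j _.
by rewrite tens_vbasis.
Qed.

Lemma tens_lfunP (W : vectType F) (f f' : 'Hom(tensor H E, W)) :
  (forall h e, f (tens h e) = f' (tens h e)) -> f = f'.
Proof.
move=> ff'; apply/lfunP=> X; rewrite [X]tens_span !linear_sum.
apply: eq_bigr => i _; rewrite !linear_sum; apply: eq_bigr => j _.
by rewrite !linearZ /= ff'.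
Qed.

(* A (x) Id *)
Definition tens_endl (A : 'End(H)) : 'End(tensor H E) :=
  tens_lift (fun h e => tens (A h) e).

Lemma tens_endlE A h e : tens_endl A (tens h e) = tens (A h) e.
Proof.
rewrite tens_lift_tens //; split=> u a x y /=.
  by rewrite linearP /= linearDl linearZl_LR.
exact: linearPr.
Qed.

Lemma tens_endl_linear : linear tens_endl.
Proof.
move=> a A B; apply: tens_lfunP => h e.
by rewrite add_lfunE scale_lfunE !tens_endlE add_lfunE scale_lfunE
  linearDl linearZl_LR.
Qed.

HB.instance Definition _ :=
  GRing.isLinear.Build F 'End(H) 'End(tensor H E) *:%R tens_endl
    tens_endl_linear.

End TensorProduct.

Section SpecialLinear.
Variables (F : fieldType) (H : vectType F).

Definition lftrace (A : 'End(H)) : F^o :=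
  \tr (mxof (vbasis {:H}) (vbasis {:H}) A).

Lemma lftrace_linear : linear lftrace.
Proof. by move=> a A B; rewrite /lftrace !linearP. Qed.

HB.instance Definition _ :=
  GRing.isLinear.Build F 'End(H) F^o *:%R lftrace lftrace_linear.

Definition sl : {vspace 'End(H)} := lker (linfun lftrace).

Lemma mem_sl A : (A \in sl) = (lftrace A == 0).
Proof. by rewrite memv_ker lfunE. Qed.

End SpecialLinear.

Section Forms.
Variable F : fieldType.

Definition pullback_form (W V : vectType F) (phi : 'Hom(W, V))
    (b : V -> V -> F) : W -> W -> F :=
  fun u v => b (phi u) (phi v).

Section Pullback.
Variables (W V : vectType F) (phi : 'Hom(W, V)) (b : {symmetric V}).

Lemma pullback_bilinear :
  bilinear_for *%R (idfun \; *%R) (pullback_form phi b).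
Proof.
split=> u a x y; rewrite /pullback_form linearP /=.
  by rewrite linearDl linearZl_LR.
by rewrite linearDr linearZr_LR.
Qed.

HB.instance Definition _ :=
  bilinear_isBilinear.Build F W W F *%R (idfun \; *%R) (pullback_form phi b)
    pullback_bilinear.

Lemma pullback_sym u v :
  pullback_form phi b u v =
  (-1) ^+ false * idfun (pullback_form phi b v u).
Proof. exact: hermitian_subproof. Qed.

HB.instance Definition _ :=
  isHermitianSesquilinear.Build F W false idfun (pullback_form phi b)
    pullback_sym.

End Pullback.

(* b|_U *)
Definition restrict_form (V : vectType F) (U : {vspace V}) (b : V -> V -> F) :
    subvs_of U -> subvs_of U -> F :=
  pullback_form (linfun vsval) b.
Arguments restrict_form [V] U b.

HB.instance Definition _ (V : vectType F) (U : {vspace V})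
    (b : {symmetric V}) :=
  Hermitian.copy (restrict_form U b) (pullback_form (linfun vsval) b).

Definition nondegenerate_subspace (V : vectType F) (b : {symmetric V})
    (U : {vspace V}) : Prop :=
  nondegenerate (restrict_form U b).

Section TensorForm.
Variables (H E : vectType F) (oH : {skew_symmetric H}) (oE : {skew_symmetric E}).

(* oH (x) oE *)
Definition tens_form (X Y : tensor H E) : F :=
  tens_lift (fun h e =>
    tens_lift (fun h' e' => oH h h' * oE e e' : F^o) Y : F^o) X.

Lemma tens_formE X Y :
  tens_form X Y =
  \sum_i \sum_j (X : 'M_(_, _)) i j * \sum_k \sum_l (Y : 'M_(_, _)) k l *
    (oH (vbasis {:H})`_i (vbasis {:H})`_k *
     oE (vbasis {:E})`_j (vbasis {:E})`_l).
Proof.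
rewrite /tens_form lfunE; apply: eq_bigr => i _; apply: eq_bigr => j _.
by rewrite lfunE.
Qed.

Lemma tens_form_sym X Y :
  tens_form X Y = (-1) ^+ false * idfun (tens_form Y X).
Proof.
rewrite expr0 mul1r /= !tens_formE.
under eq_bigr do under eq_bigr do
  (rewrite mulr_sumr; under eq_bigr do rewrite mulr_sumr).
under [RHS]eq_bigr do under eq_bigr do
  (rewrite mulr_sumr; under eq_bigr do rewrite mulr_sumr).
rewrite pair_big [RHS]pair_big /=.
under eq_bigr do rewrite pair_big /=.
under [RHS]eq_bigr do rewrite pair_big /=.
rewrite exchange_big; apply: eq_bigr => -[k l] _; apply: eq_bigr => -[i j] _ /=.
rewrite (hermitian_subproof (vbasis {:H})`_i) /=.
rewrite (hermitian_subproof (vbasis {:E})`_j) /=.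
by rewrite expr1 !mulN1r mulrNN mulrCA.
Qed.

Lemma tens_form_bilinear : bilinear_for *%R (idfun \; *%R) tens_form.
Proof.
have lin Z : GRing.linear_for *%R (tens_form ^~ Z).
  by move=> a X Y; rewrite /tens_form linearP.
split=> // X a Y Z; rewrite /= tens_form_sym lin.
by rewrite [tens_form X Y]tens_form_sym [tens_form X Z]tens_form_sym
  !expr0 !mul1r.
Qed.

HB.instance Definition _ :=
  bilinear_isBilinear.Build F (tensor H E) (tensor H E) F *%R
    (idfun \; *%R) tens_form tens_form_bilinear.

HB.instance Definition _ :=
  isHermitianSesquilinear.Build F (tensor H E) false idfun tens_form
    tens_form_sym.

Lemma tens_form_tens h e h' e' :
  tens_form (tens h e) (tens h' e') = oH h h' * oE e e'.
Proof.
have b2 h0 e0 : bilinear_for *:%R *:%R (fun h' e' => oH h0 h' * oE e0 e' : F^o).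
  split=> u a x y /=; first by rewrite linearDr linearZr_LR /= mulrDl -mulrA.
  by rewrite linearDr linearZr_LR /= mulrDr mulrCA.
have b1 : bilinear_for *:%R *:%R (fun h e => oH h h' * oE e e' : F^o).
  split=> u a x y /=; first by rewrite linearDl linearZl_LR /= mulrDl -mulrA.
  by rewrite linearDl linearZl_LR /= mulrDr mulrCA.
rewrite -[RHS](tens_lift_tens h e b1) /tens_form lfunE [RHS]lfunE.
apply: eq_bigr => i _; apply: eq_bigr => j _.
by rewrite tens_lift_tens.
Qed.

End TensorForm.
End Forms.

Section Coordinates.
Variables (F : fieldType) (H E : vectType F).

Definition tens_proj1 (h1 h2 : H) : 'Hom(tensor H E, E) :=
  tens_lift (fun h e => coord [tuple h1; h2] ord0 h *: e).

Definition tens_proj2 (h1 h2 : H) : 'Hom(tensor H E, E) :=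
  tens_lift (fun h e => coord [tuple h1; h2] ord_max h *: e).

Section Basis.
Variables h1 h2 : H.
Hypothesis h12 : basis_of {:H} [:: h1; h2].

Lemma tens_coord_lift (n : nat) (b : n.-tuple H) i h e :
  tens_lift (fun h (e : E) => coord b i h *: e) (tens h e) = coord b i h *: e.
Proof.
rewrite tens_lift_tens //; split=> u a x y /=.
  by rewrite linearP scalerDl scalerA.
by rewrite scalerDr !scalerA mulrC.
Qed.

Lemma tens_projE (X : tensor H E) :
  X = tens h1 (tens_proj1 h1 h2 X) + tens h2 (tens_proj2 h1 h2 X).
Proof.
rewrite [X]tens_span !linear_sum !linear_sumr -big_split /=.
apply: eq_bigr => i _.
rewrite !linear_sum !linear_sumr -big_split /=; apply: eq_bigr => j _.
rewrite !linearZ /= !linearZr_LR -scalerDr; congr (_ *: _).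
set h := _`_i; set e := _`_j.
rewrite !tens_coord_lift !linearZr_LR -!linearZl_LR -linearDl; congr tens.
have {1}-> := @coord_basis _ _ _ _ [tuple h1; h2] h h12 (memvf h).
by rewrite !big_ord_recl big_ord0 addr0; congr (_ *: _ + coord _ _ _ *: _);
  apply: val_inj.
Qed.

Lemma tens_projK e e' :
  (tens_proj1 h1 h2 (tens h1 e + tens h2 e') = e) *
  (tens_proj2 h1 h2 (tens h1 e + tens h2 e') = e').
Proof.
have fr : free [tuple h1; h2] := basis_free h12.
have c i j := coord_free i j fr.
have c10 := c ord0 ord0; have c11 := c ord0 ord_max.
have c20 := c ord_max ord0; have c21 := c ord_max ord_max.
rewrite /= in c10 c11 c20 c21.
by rewrite /tens_proj1 /tens_proj2 !linearD /= !tens_coord_lift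
  c10 c11 c20 c21 /= !scale1r !scale0r addr0 add0r.
Qed.

End Basis.

Definition symplectic_basis (oH : {skew_symmetric H}) (h1 h2 : H) : Prop :=
  basis_of {:H} [:: h1; h2] /\ oH h1 h2 = 1.

Section Graph.
Variables (h1 h2 : H) (S : {vspace E}) (T : 'Hom(subvs_of S, E)).

Definition graph_fun (f : subvs_of S) : tensor H E :=
  tens h1 (vsval f) + tens h2 (T f).

Lemma graph_fun_linear : linear graph_fun.
Proof.
move=> a x y.
by rewrite /graph_fun !linearP /= !linearDr !linearZr_LR /= scalerDr addrACA.
Qed.

HB.instance Definition _ :=
  GRing.isLinear.Build F (subvs_of S) (tensor H E) *:%R graph_fun
    graph_fun_linear.

Definition graph_lfun : 'Hom(subvs_of S, tensor H E) := linfun graph_fun.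

(* U^{S,T} *)
Definition graph_space : {vspace tensor H E} := limg graph_lfun.

(* T W, for W a subspace of the domain S of T *)
Definition subspace_image (W : {vspace E}) : {vspace E} :=
  (T @: (linfun vsval @^-1: W))%VS.

Lemma memv_subspace_image (W : {vspace E}) v :
  reflect (exists2 f : subvs_of S, vsval f \in W & v = T f)
          (v \in subspace_image W).
Proof.
apply: (iffP memv_imgP) => -[f fW ->]; exists f => //; move: fW.
  by rewrite -memv_preim lfunE.
by rewrite -memv_preim lfunE.
Qed.

End Graph.

(* sl(H) (x) Id *)
Definition Qtilde : {vspace 'End(tensor H E)} :=
  (linfun (@tens_endl F H E) @: sl H)%VS.

Definition admissible_basis (V : vectType F) (Q : {vspace 'End(V)})
    (I J K : 'End(V)) : Prop :=
  [/\ basis_of Q [:: I; J; K],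
      [/\ (I \o J = - (J \o I))%VF, (J \o K = - (K \o J))%VF
        & (I \o K = - (K \o I))%VF],
      [/\ (- (I \o I) = \1)%VF, (J \o J = \1)%VF & (K \o K = \1)%VF]
    & (I \o J)%VF = K].

Definition real_subspace (U : {vspace tensor H E}) : Prop :=
  forall A, A \in Qtilde -> (A @: U :&: U = 0)%VS.

Definition totally_real (b : {symmetric (tensor H E)})
    (U : {vspace tensor H E}) : Prop :=
  exists I J K, admissible_basis Qtilde I J K /\
    [/\ (I @: U <= orthov b U)%VS, (J @: U <= orthov b U)%VS
      & (K @: U <= orthov b U)%VS].

End Coordinates.

(* Main.v *)
(* In a symplectic basis, an element of sl(H) is a matrix [[p, q], [r, -p]], and
   its action sends h1 x + h2 y to h1 (p x + q y) + h2 (r x - p y).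

   Diagonal matrices show that both projections are injective on a real U, so
   U is the graph of an injective T.  If A moves some h1 f + h2 (T f) to a
   nonzero element of U, then T f lies in F and span(f, T f) is T-stable.
   Conversely, a nonzero T-stable W contains a nonzero v with
   T (T v) = a T v + b v, because a real endomorphism has an invariant line or
   plane, and some A in sl(H) then maps h1 v + h2 (T v) to a nonzero element of
   the graph.

   Total reality is the vanishing of
   p (w(e, T e') + w(T e, e')) + q w(T e, T e') - r w(e, e')
   for all p, q, r.  Since g_F(e, e') = w(e, T e') - w(T e, e') = 2 w(e, T e')
   when T is skew, isotropy of E2 puts E1 :&: E2 into the kernel of g_F. *)
Require Import Defs.
From HB Require Import structures.
From mathcomp Require Import all_boot all_order all_algebra.
From mathcomp Require Import reals.
From mathcomp Require Import complex ring.

Set Implicit Arguments.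
Unset Strict Implicit.
Unset Printing Implicit Defensive.

Import GRing.Theory Num.Theory passmx.
Local Open Scope ring_scope.

(** * Quadratic relations satisfied by endomorphisms over a real closed field *)

Lemma mul_complexr (R : rcfType) (z : R[i]) (r : R) :
  (complex.Re (z * real_complex R r) = complex.Re z * r) *
  (complex.Im (z * real_complex R r) = complex.Im z * r).
Proof. by case: z => a b; split=> /=; rewrite mulr0 ?subr0 ?add0r. Qed.

(** A complex eigenvector [w = x + i y] with eigenvalue [s + i t] exists over the algebraic closure.
    Separating real and imaginary parts shows that [M ^ 2 - 2 s M + (s ^ 2 + t ^ 2)] annihilates
    both [x] and [y], and these cannot both vanish. *)
Lemma mx_quadratic_vector (R : rcfType) n (M : 'M[R]_n) : (0 < n)%N ->
  exists v : 'rV_n, exists a b,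
    v != 0 /\ v *m M *m M = a *: (v *m M) + b *: v.
Proof.
move=> n_gt0.
have [[s t] /eigenvalueP[w wM w0]] :=
  eigenvalue_closed (map_mx (real_complex R) M) n_gt0.
pose x := map_mx (@complex.Re R) w; pose y := map_mx (@complex.Im R) w.
have xM : x *m M = s *: x - t *: y.
  apply/rowP=> j; have /rowP/(_ j)/(congr1 (@complex.Re R)) := wM.
  rewrite !mxE raddf_sum /=; case: (w 0 j) => a b /= <-.
  by apply: eq_bigr => k _; rewrite !mxE mul_complexr.
have yM : y *m M = s *: y + t *: x.
  apply/rowP=> j; have /rowP/(_ j)/(congr1 (@complex.Im R)) := wM.
  rewrite !mxE raddf_sum /=; case: (w 0 j) => a b /= <-.
  by apply: eq_bigr => k _; rewrite !mxE mul_complexr.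
have xMM : x *m M *m M = (2 * s) *: (x *m M) + (- (s ^+ 2 + t ^+ 2)) *: x.
  rewrite {1}xM mulmxBl -!scalemxAl yM xM.
  by apply/rowP=> j; rewrite !mxE; ring.
have yMM : y *m M *m M = (2 * s) *: (y *m M) + (- (s ^+ 2 + t ^+ 2)) *: y.
  rewrite {1}yM mulmxDl -!scalemxAl yM xM.
  by apply/rowP=> j; rewrite !mxE; ring.
have [x0|x0] := eqVneq x 0; last by exists x, (2 * s), (- (s ^+ 2 + t ^+ 2)).
exists y, (2 * s), (- (s ^+ 2 + t ^+ 2)); split; last exact: yMM.
apply: contraNneq w0 => y0; apply/eqP/rowP=> j; rewrite mxE.
move/rowP/(_ j): x0; move/rowP/(_ j): y0; rewrite !mxE.
by case: (w 0 j) => a b /= -> ->.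
Qed.

Lemma endo_quadratic_vector (R : rcfType) (V : vectType R) (u : 'End(V)) :
  (0 < \dim {:V})%N ->
  exists v a b, v != 0 /\ u (u v) = a *: u v + b *: v.
Proof.
move=> V0.
have e_basis := vbasisP {:V}.
have [v [a [b [v0 vM]]]] :=
  mx_quadratic_vector (mxof (vbasis {:V}) (vbasis {:V}) u) V0.
exists (vecof (vbasis {:V}) v), a, b; split; first by rewrite vecof_eq0.
rewrite !(hom_vecof _ e_basis) vM.
by rewrite linearP linearZ.
Qed.

(** Stability allows [u] to be restricted to an endomorphism [f] of the vector space [subvs_of W],
    to which the previous lemma applies. *)
Lemma stable_quadratic_vector (R : rcfType) (V : vectType R) (u : 'End(V))
    (W : {vspace V}) : W != 0%VS -> (u @: W <= W)%VS ->
  exists v a b, [/\ v \in W, v != 0 & u (u v) = a *: u v + b *: v].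
Proof.
move=> W0 uW.
have stab (w : subvs_of W) : u (vsval w) \in W.
  by apply: (subvP uW); apply: memv_img; exact: subvsP.
have W_gt0 : (0 < \dim {:subvs_of W})%N.
  by rewrite dimvf /dim /= lt0n dimv_eq0.
pose f : 'End(subvs_of W) := (linfun (vsproj W) \o u \o linfun vsval)%VF.
have fE w : vsval (f w) = u (vsval w).
  by rewrite !comp_lfunE /= lfunE lfunE /= vsprojK.
have [v [a [b [v0 fv]]]] := endo_quadratic_vector f W_gt0.
exists (vsval v), a, b; split; first exact: subvsP.
  by apply: contraNneq v0 => v0; rewrite -[v]vsvalK v0 linear0.
by rewrite -!fE fv linearD !linearZ.
Qed.

(** * Coordinates on [sl H], [Qtilde] and real subspaces relative to a basis of the plane *)

(** Independence of the basis: the change-of-basis matrices cancel by cyclicity of the trace. This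
    frees the trace from the library basis used in its definition. *)
Lemma lftraceE (F : fieldType) (H : vectType F) (n : nat) (b : n.-tuple H)
    (A : 'End(H)) :
  basis_of {:H} b -> lftrace A = \sum_i coord b i (A b`_i).
Proof.
move=> bB; have dimHn := size_basis bB; subst n.
have -> : \sum_i coord b i (A b`_i) = \tr (mxof b b A).
  by apply: eq_bigr => i _; rewrite !mxE /= vecof_delta.
have vB := vbasisP {:H}.
have -> : mxof b b A = mxof b (vbasis {:H}) \1 *m
    mxof (vbasis {:H}) (vbasis {:H}) A *m mxof (vbasis {:H}) b \1.
  by rewrite -!mxof_comp // comp_lfun1l comp_lfun1r.
rewrite -mulmxA mxtrace_mulC -mulmxA -mxof_comp // comp_lfun1r.
by rewrite mxof1 ?mulmx1 // (basis_free vB).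
Qed.

Section Plane.
Variables (F : fieldType) (H E : vectType F) (h1 h2 : H).
Hypothesis h12 : basis_of {:H} [:: h1; h2].

Let b := [tuple h1; h2].
Let bB : basis_of {:H} b := h12.

Let coordE (x y : F) : 
  (coord b ord0 (x *: h1 + y *: h2) = x) *
  (coord b ord_max (x *: h1 + y *: h2) = y).
Proof.
have fr : free b := basis_free h12.
have c i j := coord_free i j fr.
have c10 := c ord0 ord0; have c11 := c ord0 ord_max.
have c20 := c ord_max ord0; have c21 := c ord_max ord_max.
rewrite /= in c10 c11 c20 c21.
by rewrite !linearD !linearZ /= c10 c11 c20 c21 /= !mulr1 !mulr0 addr0 add0r.
Qed.

Lemma plane_eq0 x y : x *: h1 + y *: h2 = 0 -> x = 0 /\ y = 0.
Proof.
by move=> xy0; have := coordE x y; rewrite xy0 !linear0 => -[<- <-].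
Qed.

Lemma plane_coord h : exists x y, h = x *: h1 + y *: h2.
Proof.
exists (coord b ord0 h), (coord b ord_max h).
rewrite {1}(coord_basis bB (memvf h)) !big_ord_recl big_ord0 addr0 /=.
by congr (_ *: _ + coord _ _ _ *: _); apply: val_inj.
Qed.

Lemma plane_lfunP (W : vectType F) (A B : 'Hom(H, W)) :
  A h1 = B h1 -> A h2 = B h2 -> A = B.
Proof.
move=> AB1 AB2; apply/lfunP=> h; have [x [y ->]] := plane_coord h.
by rewrite !linearD !linearZ /= AB1 AB2.
Qed.

Lemma plane_lfun (W : vectType F) (w1 w2 : W) :
  {A : 'Hom(H, W) | A h1 = w1 /\ A h2 = w2}.
Proof.
have [f fE] := linear_of_free [:: h1; h2] [:: w1; w2].
exists (linfun f); rewrite !lfunE.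
by have [-> ->] := fE (basis_free h12) erefl.
Qed.

Lemma lftrace_plane (A : 'End(H)) p q r s :
  A h1 = p *: h1 + r *: h2 -> A h2 = q *: h1 + s *: h2 -> lftrace A = p + s.
Proof.
move=> A1 A2; rewrite (lftraceE _ bB) !big_ord_recl big_ord0 addr0 /=.
rewrite (_ : lift ord0 ord0 = ord_max) /=; last exact: val_inj.
by rewrite A1 A2 !coordE.
Qed.

Lemma sl_planeP (A : 'End(H)) :
  reflect (exists p q r,
    A h1 = p *: h1 + r *: h2 /\ A h2 = q *: h1 - p *: h2) (A \in sl H).
Proof.
rewrite mem_sl; apply: (iffP eqP) => [A0|[p [q [r [A1]]]]]; last first.
  by rewrite -scaleNr => A2; rewrite (lftrace_plane A1 A2) subrr.
have [p [r A1]] := plane_coord (A h1); have [q [s A2]] := plane_coord (A h2).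
exists p, q, r; split=> //; rewrite A2 -scaleNr; congr (_ + _ *: _).
by apply/eqP; rewrite -addr_eq0 addrC -(lftrace_plane A1 A2) A0.
Qed.

Definition sl_plane p q r : 'End(H) :=
  sval (plane_lfun (p *: h1 + r *: h2) (q *: h1 - p *: h2)).

Lemma sl_planeE p q r :
  (sl_plane p q r h1 = p *: h1 + r *: h2) *
  (sl_plane p q r h2 = q *: h1 - p *: h2).
Proof. by rewrite /sl_plane; case: plane_lfun => A /= []. Qed.

Lemma mem_sl_plane p q r : sl_plane p q r \in sl H.
Proof. by apply/sl_planeP; exists p, q, r; rewrite !sl_planeE. Qed.

Definition Qtilde_plane p q r : 'End(tensor H E) :=
  tens_endl E (sl_plane p q r).

Lemma Qtilde_planeP (A : 'End(tensor H E)) :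
  reflect (exists p q r, A = Qtilde_plane p q r) (A \in Qtilde H E).
Proof.
apply: (iffP memv_imgP) => [[B /sl_planeP[p [q [r [B1 B2]]]] ->]|].
  exists p, q, r; rewrite lfunE /=; congr tens_endl.
  by apply: plane_lfunP; rewrite !sl_planeE.
move=> [p [q [r ->]]]; exists (sl_plane p q r); rewrite ?lfunE //.
exact: mem_sl_plane.
Qed.

Lemma Qtilde_planeE p q r x y :
  Qtilde_plane p q r (tens h1 x + tens h2 y) =
  tens h1 (p *: x + q *: y) + tens h2 (r *: x - p *: y).
Proof.
rewrite linearD /= !tens_endlE !sl_planeE.
rewrite !linearDl /= !linearNl /= !linearDr /= !linearNr /=.
by rewrite !linearZl_LR !linearZr_LR /= addrACA.
Qed.

Lemma tens_plane_inj x y x' y' :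
  tens h1 x + tens h2 y = tens h1 x' + tens h2 y' :> tensor H E ->
  x = x' /\ y = y'.
Proof.
move=> xy; have [p1 p2] := tens_projK h12 x y.
have [p1' p2'] := tens_projK h12 x' y'.
by split; [rewrite -p1 xy | rewrite -p2 xy].
Qed.

Lemma tens_plane_eq0 x y : tens h1 x + tens h2 y = 0 :> tensor H E ->
  x = 0 /\ y = 0.
Proof.
have <- : tens h1 0 + tens h2 0 = 0 :> tensor H E by rewrite !linear0r addr0.
exact: tens_plane_inj.
Qed.

(** This is the form in which reality is used below: each later argument only has to choose the
    entries [p], [q], [r] and a vector of [U]. *)
Lemma real_subspace_planeP (U : {vspace tensor H E}) :
  real_subspace U <-> forall p q r x y, tens h1 x + tens h2 y \in U ->
    tens h1 (p *: x + q *: y) + tens h2 (r *: x - p *: y) \in U ->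
    p *: x + q *: y = 0 /\ r *: x - p *: y = 0.
Proof.
split=> [realU p q r x y xyU AxyU | realU A /Qtilde_planeP[p [q [r ->]]]].
  apply: tens_plane_eq0; apply/eqP; rewrite -memv0.
  rewrite -(realU (Qtilde_plane p q r)); last first.
    by apply/Qtilde_planeP; do 3!eexists.
  by rewrite memv_cap AxyU -Qtilde_planeE memv_img.
apply/eqP; rewrite -subv0; apply/subvP=> v.
rewrite memv_cap => /andP[/memv_imgP[u uU ->]].
move: uU; rewrite [u](tens_projE h12) Qtilde_planeE => uU AuU.
by have [-> ->] := realU _ _ _ _ _ uU AuU; rewrite !linear0r addr0 mem0v.
Qed.

Lemma tens_eq0 (h : H) (e : E) : tens h e = 0 -> e != 0 -> h = 0.
Proof.
have [x [y ->]] := plane_coord h; rewrite linearDl !linearZl_LR -!linearZr_LR.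
move=> /tens_plane_eq0[/eqP xe /eqP ye] e0; move: xe ye.
rewrite !scaler_eq0 (negPf e0) !orbF => /eqP-> /eqP->.
by rewrite !scale0r addr0.
Qed.

(** Applying [A (x) Id] to [tens h e] for one fixed nonzero [e] recovers [A h]. Faithfulness carries
    a basis of [sl H] to a basis of [Qtilde]. *)
Lemma lker_tens_endl :
  (0 < \dim {:E})%N -> lker (linfun (@tens_endl F H E)) = 0%VS.
Proof.
move=> E_gt0; apply/eqP; rewrite -subv0; apply/subvP=> A.
rewrite memv_ker lfunE memv0 => /eqP A0; apply/eqP/lfunP=> h.
rewrite lfunE; apply: (@tens_eq0 _ (vpick {:E})).
  by rewrite -tens_endlE A0 lfunE.
by rewrite vpick0 -dimv_eq0 -lt0n.
Qed.

End Plane.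

(** * Membership, projections and dimensions for graph subspaces *)

Section Graph.
Variables (F : fieldType) (H E : vectType F) (h1 h2 : H).
Hypothesis h12 : basis_of {:H} [:: h1; h2].
Variables (S : {vspace E}) (T : 'Hom(subvs_of S, E)).

Lemma graph_lfunE f :
  graph_lfun h1 h2 T f = tens h1 (vsval f) + tens h2 (T f).
Proof. by rewrite lfunE. Qed.

Lemma memv_graph x y :
  reflect (exists2 f, x = vsval f & y = T f)
    (tens h1 x + tens h2 y \in graph_space h1 h2 T).
Proof.
apply: (iffP memv_imgP) => [[f _]|[f -> ->]]; last first.
  by exists f; rewrite ?memvf // graph_lfunE.
by rewrite graph_lfunE => /(tens_plane_inj h12)[-> ->]; exists f.
Qed.

Lemma graph_proj2 : (tens_proj2 E h1 h2 @: graph_space h1 h2 T = limg T)%VS.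
Proof.
apply/vspaceP=> v; apply/memv_imgP/memv_imgP => [[u /memv_imgP[f _ ->] ->]|].
  by exists f; rewrite ?memvf // graph_lfunE (tens_projK h12).
move=> [f _ ->]; exists (graph_lfun h1 h2 T f).
  by rewrite memv_img ?memvf.
by rewrite graph_lfunE (tens_projK h12).
Qed.

End Graph.

(** Both [vsval], restricted to the preimage of [W], and [T] are injective. The equality of
    dimensions later upgrades an inclusion of [T W] in [W] to an equality. *)
Lemma dim_subspace_image (F : fieldType) (E : vectType F) (S : {vspace E})
    (T : 'Hom(subvs_of S, E)) (W : {vspace E}) :
  lker T = 0%VS -> (W <= S)%VS -> \dim (subspace_image T W) = \dim W.
Proof.
move=> kT WS; rewrite /subspace_image limg_dim_eq ?kT ?capv0 //.
rewrite -[in RHS](@lpreimK _ _ _ (linfun (@vsval _ _ S)) W); last first.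
  apply/subvP=> w wW; apply/memv_imgP; exists (vsproj S w); rewrite ?memvf //.
  by rewrite lfunE /= vsprojK // (subvP WS).
rewrite limg_dim_eq //; apply/eqP; rewrite -subv0; apply/subvP=> w.
rewrite memv_cap memv_ker lfunE => /andP[_ /eqP w0].
by rewrite memv0 -[w]vsvalK w0 linear0.
Qed.

(** * Real subspaces as graphs without stable subspaces *)

Section RealSubspaces.
Variables (F : numFieldType) (H E : vectType F) (h1 h2 : H).
Hypothesis h12 : basis_of {:H} [:: h1; h2].

Lemma real_subspace_graph (U : {vspace tensor H E}) : real_subspace U ->
  exists T : 'Hom(subvs_of (tens_proj1 E h1 h2 @: U), E),
    [/\ U = graph_space h1 h2 T, lker T = 0%VS
      & limg T = (tens_proj2 E h1 h2 @: U)%VS].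
Proof.
set p1 := tens_proj1 E h1 h2; set p2 := tens_proj2 E h1 h2.
move/(real_subspace_planeP h12) => realU.
have inj1 x : tens h1 x + tens h2 0 \in U -> x = 0.
  (* The matrix [diag(1, -1)] fixes [h1 x], and in [inj2] it negates [h2 y]; either way the image
     stays in [U], so reality makes it zero. *)
  move=> xU; have := realU 1 0 0 x 0 xU.
  by rewrite !scale0r !scale1r !addr0 subr0 => /(_ xU)[].
have inj2 y : tens h1 0 + tens h2 y \in U -> y = 0.
  move=> yU; have := realU 1 0 0 0 y yU.
  rewrite !scale0r !scale1r !addr0 sub0r linearNr -memvN opprD opprK.
  move: yU; rewrite !linear0r oppr0 !add0r => yU /(_ yU)[_ /eqP].
  by rewrite oppr_eq0 => /eqP.
(* A linear section of [p1] over [p1 @: U]: a generalised inverse of [p1] composed with the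
   projection to [U], projected again so that every value lies in [U]. *)
pose s : 'Hom(E, tensor H E) := (projv U \o (p1 \o projv U)^-1)%VF.
have sU e : s e \in U by rewrite comp_lfunE memv_proj.
have p1s e : e \in (p1 @: U)%VS -> p1 (s e) = e.
  move=> /memv_imgP[u uU ->]; rewrite /s comp_lfunE -[LHS]comp_lfunE.
  by rewrite limg_lfunVK // -{1}(projv_id uU) -comp_lfunE memv_img ?memvf.
pose T : 'Hom(subvs_of (p1 @: U), E) := (p2 \o s \o linfun vsval)%VF.
have TE f : T f = p2 (s (vsval f)).
  by rewrite 2!comp_lfunE; congr (p2 (s _)); rewrite lfunE.
have eqU : U = graph_space h1 h2 T.
  apply/vspaceP=> u; rewrite [u](tens_projE h12) -/p1 -/p2.
  apply/idP/(memv_graph h12)=> [uU|[f -> ->]]; last first.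
    by rewrite TE -{1}[vsval f]p1s ?subvsP // -(tens_projE h12).
  rewrite -(tens_projE h12) in uU.
  have u1 : p1 u \in (p1 @: U)%VS by rewrite memv_img.
  exists (vsproj _ (p1 u)); rewrite ?TE vsprojK //.
  (* The vector [u - s (p1 u)] of [U] has first component zero, so [inj2] kills its second
     component, which is [p2 u - T (p1 u)]. *)
  apply/eqP; rewrite -subr_eq0 -linearB; apply/eqP/inj2.
  have p1_0 : p1 (u - s (p1 u)) = 0 by rewrite linearB /= p1s ?subrr.
  by rewrite -{1}p1_0 -(tens_projE h12) memvB.
exists T; split=> //; last by rewrite -(graph_proj2 h12 T) -eqU.
apply/eqP; rewrite -subv0; apply/subvP=> f; rewrite memv_ker memv0 => /eqP Tf0.
have : tens h1 (vsval f) + tens h2 0 \in graph_space h1 h2 T.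
  by apply/(memv_graph h12); exists f.
by rewrite -eqU => /inj1 f0; rewrite -[f]vsvalK f0 linear0.
Qed.

Variables (S : {vspace E}) (T : 'Hom(subvs_of S, E)).
Hypothesis kT : lker T = 0%VS.

Lemma no_stable_real_graph :
  (forall W : {vspace E}, W <> 0%VS -> (W <= S :&: limg T)%VS ->
     ~ (subspace_image T W <= W)%VS) ->
  real_subspace (graph_space h1 h2 T).
Proof.
move=> noW; apply/(real_subspace_planeP h12) => p q r x' y'.
move=> /(memv_graph h12)[f -> ->] {x' y'} /(memv_graph h12)[k ek eTk].
rewrite ek eTk; have [->|k0] := eqVneq k 0; first by rewrite !linear0.
exfalso; set x := vsval f in ek eTk; set y := T f in ek eTk.
have f0 : f != 0.
  apply: contraNneq k0 => f0; apply/eqP/val_inj; rewrite /= -ek /x /y f0.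
  by rewrite !linear0 ?scaler0 addr0.
(* If [q = 0], then [k = p f], and comparing [T k = p y] with [r x - p y] gives [y = r / (2 p) x].
   If [q] is nonzero, [y] is a combination of [vsval k] and [x], both in [S], and [T] sends it to a
   combination of [T k = r x - p y] and [y]. *)
have [yS Tystab] : y \in S /\ T (vsproj S y) \in (<[x]> + <[y]>)%VS.
  have [q0|q0] := eqVneq q 0.
    move: ek; rewrite q0 scale0r addr0 => ek.
    have kE : k = p *: f by apply: val_inj; rewrite /= -ek.
    have p0 : p != 0 by apply: contraNneq k0 => p0; rewrite kE p0 scale0r.
    have yE : y = (r / (2 * p)) *: x.
      have Tk : T k = p *: y by rewrite kE linearZ.
      move: eTk; rewrite Tk => /eqP.
      rewrite subr_eq -scalerDl -mulr2n -[p *+ 2]mulr_natl => /eqP eTk.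
      apply: (@scalerI _ _ (2 * p)); first by rewrite mulf_neq0 // pnatr_eq0.
      by rewrite -eTk scalerA mulrC divfK // mulf_neq0 // pnatr_eq0.
    split; first by rewrite yE memvZ ?subvsP.
    rewrite yE linearZ linearZ /= vsvalK memvZ // -/y -yE.
    by rewrite memvE addvSr.
  have yE : y = q^-1 *: (vsval k - p *: x).
    by rewrite -ek addrAC subrr add0r scalerA mulVf ?scale1r.
  split; first by rewrite yE memvZ ?memvB ?memvZ ?subvsP.
  rewrite {1}yE linearZ linearB linearZ /= linearZ linearB linearZ /=.
  rewrite !vsvalK -eTk -/y memvZ // memvB ?memvB ?memvZ //;
  by rewrite memvE ?addvSl ?addvSr.
pose W := (<[x]> + <[y]>)%VS.
have xW : x \in W by rewrite memvE addvSl.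
have yW : y \in W by rewrite memvE addvSr.
have WS : (W <= S)%VS by rewrite subv_add -!memvE yS subvsP.
have TW : (subspace_image T W <= W)%VS.
  apply/subvP=> _ /memv_subspace_image[g gW ->].
  have [_ /vlineP[a ->] [_ /vlineP[c ->] gE]] := memv_addP gW.
  have -> : g = a *: f + c *: vsproj S y.
    by apply: val_inj; rewrite /= gE vsprojK.
  by rewrite linearD !linearZ /= memvD ?memvZ.
(* Equality, rather than inclusion, places [W] inside [limg T], as [noW] demands. *)
have TWE : subspace_image T W = W.
  by apply/eqP; rewrite eqEdim TW dim_subspace_image /=.
apply: (noW W _ _ TW).
  move=> W0; move: xW; rewrite W0 memv0 => /eqP x0; move: f0.
  by rewrite -[f]vsvalK -/x x0 linear0 eqxx.
by rewrite subv_cap WS -{1}TWE limgS ?subvf.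
Qed.

End RealSubspaces.

Lemma real_graph_no_stable (R : rcfType) (H E : vectType R) (h1 h2 : H)
    (S : {vspace E}) (T : 'Hom(subvs_of S, E)) :
  basis_of {:H} [:: h1; h2] -> real_subspace (graph_space h1 h2 T) ->
  forall W : {vspace E}, W <> 0%VS -> (W <= S)%VS ->
    ~ (subspace_image T W <= W)%VS.
Proof.
move=> h12 /(real_subspace_planeP h12) realU W /eqP W0 WS TW.
(* Precomposing with the projection to [S] extends [T] to all of [E], so that stability of [W]
   concerns an endomorphism. *)
pose u : 'End(E) := (T \o linfun (vsproj S))%VF.
have uE w : u w = T (vsproj S w) by rewrite comp_lfunE lfunE.
have graph_u x : x \in W -> tens h1 x + tens h2 (u x) \in graph_space h1 h2 T.
  move=> /(subvP WS) xS; apply/(memv_graph h12).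
  by exists (vsproj S x); rewrite ?vsprojK.
have uW : (u @: W <= W)%VS.
  apply/subvP=> _ /memv_imgP[w wW ->]; rewrite uE; apply: (subvP TW).
  apply/memv_subspace_image.
  by exists (vsproj S w); rewrite ?vsprojK ?(subvP WS).
have [v [a [b [vW /eqP v0 uuv]]]] := stable_quadratic_vector W0 uW.
have uvW : u v \in W by apply: (subvP uW); apply: memv_img.
(* If [u v = c v], the matrix [[[1, 0], [2 c, -1]]] fixes the nonzero vector [h1 v + h2 (c v)] of
   the graph, contradicting reality. *)
have eig c : u v = c *: v -> False.
  move=> uv; have := realU 1 0 (2 * c) v (u v) (graph_u v vW).
  have -> : (2 * c) *: v - 1 *: u v = u v.
    by rewrite scale1r uv -scalerBl; congr (_ *: _); ring.
  by rewrite scale0r addr0 scale1r graph_u // => /(_ isT)[].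
(* [A = [[-a, 2], [2 b, a]]] maps [h1 v + h2 (u v)] into the graph precisely
   because [u (u v) = a u v + b v]. *)
have := realU (- a) 2 (2 * b) v (u v) (graph_u v vW).
have -> : (2 * b) *: v - - a *: u v = u (- a *: v + 2 *: u v).
  rewrite linearD !linearZ /= uuv scalerDr !scalerA addrA -scalerDl.
  by rewrite scalerN -scaleNr [LHS]addrC; congr (_ *: _ + _); ring.
rewrite graph_u; last by rewrite memvD ?memvZ.
(* Reality makes the first component [- a v + 2 u v] vanish, so [v] is an eigenvector for [a / 2],
   which [eig] excludes. *)
move=> /(_ isT)[/eqP]; rewrite scaleNr addrC subr_eq0 => /eqP uv _.
apply: (eig (2^-1 * a)); apply: (@scalerI _ _ (2 : R)).
  by rewrite pnatr_eq0.
by rewrite uv scalerA mulrA divff ?mul1r ?pnatr_eq0.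
Qed.

(** * Nondegeneracy of a subspace and of the pulled-back form *)

Section Nondegenerate.
Variable F : fieldType.

Lemma nondegenerateP (V : vectType F) (b : {symmetric V}) :
  nondegenerate b <-> forall u, (forall v, b u v = 0) -> u = 0.
Proof.
split=> [/eqP nb u bu|nb].
  by apply/eqP; rewrite -memv0 -nb; apply/mem_orthovP=> v _; exact: bu.
apply/eqP/vspaceP=> u; rewrite memv0; apply/idP/eqP=> [/mem_orthovP bu|->].
  by apply: nb => v; apply: bu; rewrite memvf.
exact: mem0v.
Qed.

(** An injective [phi] is an isometry from [W] with the pulled-back form onto its image, so the two
    radicals correspond. For the graph map this is the criterion by [g_F]. *)
Lemma nondegenerate_limg (W V : vectType F) (phi : 'Hom(W, V))
    (b : {symmetric V}) : lker phi = 0%VS ->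
  nondegenerate_subspace b (limg phi) <-> nondegenerate (pullback_form phi b).
Proof.
move=> kphi; have injphi : injective phi by apply/lker0P/eqP.
have resE (u v : subvs_of (limg phi)) : restrict_form b u v =
    b (vsval u) (vsval v).
  by rewrite /restrict_form /pullback_form !lfunE.
rewrite /nondegenerate_subspace !nondegenerateP; split=> nb w bw.
  have phi_w : vsval (vsproj (limg phi) (phi w)) = phi w.
    by rewrite vsprojK // memv_img ?memvf.
  apply: injphi; rewrite linear0 -phi_w (nb (vsproj _ (phi w))) ?linear0 //.
  move=> v; have /memv_imgP[w' _ vE] := subvsP v.
  by rewrite /= resE phi_w vE; exact: bw.
have /memv_imgP[w' _ wE] := subvsP w.
rewrite -[w]vsvalK wE (nb w') ?linear0 // => v.
have := bw (vsproj _ (phi v)).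
by rewrite /= resE wE vsprojK // memv_img ?memvf.
Qed.

Lemma lker_graph_lfun (H E : vectType F) (h1 h2 : H) (S : {vspace E})
    (T : 'Hom(subvs_of S, E)) :
  basis_of {:H} [:: h1; h2] -> lker (graph_lfun h1 h2 T) = 0%VS.
Proof.
move=> h12; apply/eqP; rewrite -subv0; apply/subvP=> f.
rewrite memv_ker graph_lfunE memv0 => /eqP /(tens_plane_eq0 h12)[f0 _].
by rewrite -[f]vsvalK f0 linear0.
Qed.

End Nondegenerate.

(** * Admissible bases and total reality *)

Lemma skewE (F : fieldType) (V : vectType F) (o : {skew_symmetric V}) u v :
  o u v = - o v u.
Proof. by rewrite [LHS]hermitian_subproof /= expr1 mulN1r. Qed.

Lemma skew_self (F : numFieldType) (V : vectType F) (o : {skew_symmetric V}) u :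
  o u u = 0.
Proof.
apply/eqP; have /eqP := skewE o u u.
by rewrite -addr_eq0 -mulr2n -mulr_natl mulf_eq0 pnatr_eq0.
Qed.

Section TotallyReal.
Variables (F : numFieldType) (H E : vectType F) (h1 h2 : H).
Hypothesis h12 : basis_of {:H} [:: h1; h2].

Let two_neq0 : 2 != 0 :> F. Proof. by rewrite pnatr_eq0. Qed.

(** These are the split-quaternion units [I = [[0, -1], [1, 0]]], [J = diag(1, -1)] and [K = I J =
    [[0, 1], [1, 0]]]. The entries [q = c - a] and [r = a + c] of [a I + b J + c K] invert to
    [a = (r - q) / 2] and [c = (r + q) / 2]. *)
Lemma sl_plane_basis :
  basis_of (sl H) [:: sl_plane h12 0 (-1) 1; sl_plane h12 1 0 0;
                      sl_plane h12 0 1 1].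
Proof.
set I := sl_plane _ _ _ _; set J := sl_plane _ 1 _ _; set K := sl_plane _ _ _ 1.
have comb a b c : a *: I + b *: J + c *: K = sl_plane h12 b (c - a) (a + c).
  apply: (plane_lfunP h12); rewrite !add_lfunE !scale_lfunE !sl_planeE;
  rewrite ?(scale0r, scale1r, scaleN1r, scaleNr, scalerN, scaler0, add0r,
    addr0, subr0, oppr0, scalerDl, scalerDr).
    by rewrite addrAC addrC.
  by rewrite (addrC (c *: h1)) addrAC.
rewrite basisEdim; apply/andP; split.
  apply/subvP=> A /(sl_planeP h12)[p [q [r [A1 A2]]]].
  have -> : A = (r - q) / 2 *: I + p *: J + (r + q) / 2 *: K.
    rewrite comb; apply: (plane_lfunP h12); rewrite sl_planeE ?A1 ?A2.
      by congr (_ + _ *: _); field.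
    by congr (_ *: _ - _); field.
  by rewrite !memvD ?memvZ // memv_span // !inE eqxx ?orbT.
(* Linear independence gives the span dimension 3, and the span lies in [sl H], so [\dim (sl H)] is
   at least 3. *)
rewrite [size _]/=; have <- : \dim <<[:: I; J; K]>> = 3%N.
  apply/eqP; rewrite -[_ == _]/(free _).
  apply/(@freeP _ _ _ [tuple I; J; K]) => k.
  rewrite !big_ord_recl big_ord0 addr0 /= addrA comb => k0.
  have := congr1 (fun A : 'End(H) => A h1) k0.
  rewrite sl_planeE lfunE => /(plane_eq0 h12)[k1 kp].
  have := congr1 (fun A : 'End(H) => A h2) k0.
  rewrite sl_planeE lfunE /= -scaleNr => /(plane_eq0 h12)[km _].
  move: k1 kp km; set a := k ord0; set b := k _; set c := k _ => b0 ac ca.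
  have c0 : c = 0.
    by apply: (mulfI two_neq0); rewrite mulr0 -[RHS](addr0 0) -{1}ac -ca; ring.
  have a0 : a = 0 by move: ac; rewrite c0 addr0.
  by case=> -[|[|[|//]]] lti; [rewrite -a0|rewrite -b0|rewrite -c0]; congr k;
    apply: val_inj.
by rewrite dimvS //; apply/span_subvP => A; rewrite !inE
  => /or3P[]/eqP->; exact: mem_sl_plane.
Qed.

(** The basis property is transported along the injective map [A |-> A (x) Id]; the algebraic
    relations are checked on vectors [h1 x + h2 y]. *)
Lemma Qtilde_plane_basis : (0 < \dim {:E})%N ->
  admissible_basis (Qtilde H E) (Qtilde_plane E h12 0 (-1) 1)
    (Qtilde_plane E h12 1 0 0) (Qtilde_plane E h12 0 1 1).
Proof.
move=> E_gt0.
have QP (A B : 'End(tensor H E)) :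
    (forall x y, A (tens h1 x + tens h2 y) = B (tens h1 x + tens h2 y)) ->
    A = B.
  by move=> AB; apply/lfunP=> X; rewrite [X](tens_projE h12).
split.
- have := limg_basis_of _ sl_plane_basis.
  move=> /(_ _ (linfun (@tens_endl F H E))).
  rewrite (lker_tens_endl h12) // capv0.
  by move=> /(_ erefl); rewrite /= !lfunE.
- split; apply: QP => x y; rewrite opp_lfunE !comp_lfunE !Qtilde_planeE;
  by rewrite ?(scale0r, scale1r, scaleN1r, add0r, addr0, subr0, sub0r, opprK,
    opprD, linearNr).
- split; apply: QP => x y;
  rewrite ?opp_lfunE !comp_lfunE !Qtilde_planeE id_lfunE;
  by rewrite ?(scale0r, scale1r, scaleN1r, add0r, addr0, subr0, sub0r, opprK,
    opprD, linearNr).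
- apply: QP => x y; rewrite !comp_lfunE !Qtilde_planeE;
  by rewrite ?(scale0r, scale1r, scaleN1r, add0r, addr0, subr0, sub0r, opprK,
    opprD, linearNr).
Qed.

(** Orthogonality of [A U] to [U] is linear in [A], so checking one basis checks all of [Qtilde].
    Hence the choice of admissible basis is immaterial; the explicit one above serves as witness for
    the converse. *)
Lemma totally_realP (b : {symmetric (tensor H E)}) (U : {vspace tensor H E}) :
  (0 < \dim {:E})%N ->
  totally_real b U <->
  forall A, A \in Qtilde H E -> (A @: U <= orthov b U)%VS.
Proof.
move=> E_gt0; split=> [[I [J [K [[QB _ _ _] [IU JU KU]]]]] A AQ|AU].
  apply/subvP=> _ /memv_imgP[u uU ->].
  rewrite (@coord_basis _ _ _ _ [tuple I; J; K] _ QB AQ).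
  rewrite !big_ord_recl big_ord0 addr0 !add_lfunE !scale_lfunE /=.
  by rewrite !memvD ?memvZ //; [apply: (subvP IU) | apply: (subvP JU) |
    apply: (subvP KU)]; rewrite memv_img.
have QB := Qtilde_plane_basis E_gt0; do 3!eexists; split; first exact: QB.
by split; apply: AU; apply/(Qtilde_planeP h12); do 3!eexists.
Qed.

Variables (oH : {skew_symmetric H}) (oE : {skew_symmetric E}).
Hypothesis oH12 : oH h1 h2 = 1.

Lemma tens_form_plane x y x' y' :
  tens_form oH oE (tens h1 x + tens h2 y) (tens h1 x' + tens h2 y') =
  oE x y' - oE y x'.
Proof.
rewrite !linearDl !linearDr /= !tens_form_tens !skew_self oH12.
by rewrite (skewE oH h2) oH12 !mul0r add0r addr0 mul1r mulN1r.
Qed.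

Variables (S : {vspace E}) (T : 'Hom(subvs_of S, E)).

Let isotropic_skew : Prop :=
  [/\ {in S &, forall e e', oE e e' = 0},
      {in limg T &, forall e e', oE e e' = 0}
    & forall e e' : subvs_of S,
        oE (T e) (vsval e') = - oE (vsval e) (T e')].

Lemma totally_real_graph : (0 < \dim {:E})%N ->
  totally_real (tens_form oH oE) (graph_space h1 h2 T) <-> isotropic_skew.
Proof.
move=> E_gt0.
have trP : totally_real (tens_form oH oE) (graph_space h1 h2 T) <->
  forall p q r (e e' : subvs_of S),
    p * (oE (vsval e) (T e') + oE (T e) (vsval e')) + q * oE (T e) (T e') -
      r * oE (vsval e) (vsval e') = 0.
  have gE p q r (e e' : subvs_of S) :
    tens_form oH oE (Qtilde_plane E h12 p q r (graph_lfun h1 h2 T e))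
      (graph_lfun h1 h2 T e') =
    p * (oE (vsval e) (T e') + oE (T e) (vsval e')) + q * oE (T e) (T e') -
      r * oE (vsval e) (vsval e').
    rewrite !graph_lfunE Qtilde_planeE tens_form_plane.
    by rewrite !linearDl !linearNl !linearZl_LR /=; ring.
  apply: (iff_trans (totally_realP _ _ E_gt0)); split=> [AU p q r e e'|AU A].
    have /AU /orthovP Ao : Qtilde_plane E h12 p q r \in Qtilde H E.
      by apply/(Qtilde_planeP h12); do 3!eexists.
    by rewrite -gE Ao // ?memv_img ?memvf.
  move=> /(Qtilde_planeP h12)[p [q [r ->]]]; apply/orthovP=> u v.
  move=> /memv_imgP[_ /memv_imgP[e _ ->] ->] /memv_imgP[e' _ ->].
  by rewrite -(AU p q r e e') -gE.
apply: (iff_trans trP); split=> [AU|[oS oT oST] p q r e e']; last first.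
  rewrite (oS _ _ (subvsP e) (subvsP e')) oST subrr.
  rewrite (oT _ _ (memv_img T (memvf e)) (memv_img T (memvf e'))).
  by rewrite !mulr0 subr0 addr0.
split.
(* The triples [(0, 0, -1)], [(0, 1, 0)] and [(1, 0, 0)] for [(p, q, r)] isolate isotropy of [S],
   isotropy of [limg T] and skew-symmetry of [T]. *)
- move=> e e' eS e'S; have := AU 0 0 (-1) (vsproj S e) (vsproj S e').
  by rewrite !vsprojK // !mul0r !add0r mulN1r opprK.
- move=> _ _ /memv_imgP[e _ ->] /memv_imgP[e' _ ->]; have := AU 0 1 0 e e'.
  by rewrite !mul0r subr0 add0r mul1r.
move=> e e'; have := AU 1 0 0 e e'.
by rewrite !mul0r subr0 addr0 mul1r addrC => /eqP; rewrite addr_eq0 => /eqP.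
Qed.

Lemma isotropic_skew_disjoint :
  nondegenerate_subspace (tens_form oH oE) (graph_space h1 h2 T) ->
  isotropic_skew -> (S :&: limg T = 0)%VS.
Proof.
move=> /(nondegenerate_limg _ (lker_graph_lfun T h12)) /nondegenerateP nd.
move=> [oS oT oST]; apply/eqP; rewrite -subv0; apply/subvP=> x.
rewrite memv_cap memv0 => /andP[xS xT]; apply/eqP.
rewrite -(vsprojK xS) (nd (vsproj S x)) ?linear0 // => f.
rewrite /= /pullback_form !graph_lfunE tens_form_plane oST opprK vsprojK //.
by rewrite oT ?memv_img ?memvf // addr0.
Qed.

End TotallyReal.

Theorem theorem3p29 (R : realType) (n : nat) (H E : vectType R)
    (oH : {skew_symmetric H}) (oE : {skew_symmetric E})
    (n_gt0 : (0 < n)%N) (dimH : \dim {:H} = 2%N)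
    (dimE : \dim {:E} = (2 * n)%N)
    (sympH : is_psymplectic oH) (sympE : is_psymplectic oE)
    (h1 h2 : H) (h12 : symplectic_basis oH h1 h2) :
  let g : {symmetric (tensor H E)} := tens_form oH oE in
  let p1 : 'Hom(tensor H E, E) := tens_proj1 E h1 h2 in
  let p2 : 'Hom(tensor H E, E) := tens_proj2 E h1 h2 in
  [/\ (forall U : {vspace tensor H E},
         real_subspace U <->
         exists T : 'Hom(subvs_of (p1 @: U), E),
           [/\ U = graph_space h1 h2 T,
               lker T = 0%VS /\ limg T = (p2 @: U)%VS
             & forall W : {vspace E}, W <> 0%VS ->
                 (W <= p1 @: U :&: limg T)%VS ->
                 ~ (subspace_image T W <= W)%VS]),
      (forall (S : {vspace E}) (T : 'Hom(subvs_of S, E)),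
         nondegenerate_subspace g (graph_space h1 h2 T) <->
         nondegenerate (pullback_form (graph_lfun h1 h2 T) g))
    & (forall U : {vspace tensor H E},
         real_subspace U -> nondegenerate_subspace g U ->
         forall T : 'Hom(subvs_of (p1 @: U), E), U = graph_space h1 h2 T ->
         let E1 := (p1 @: U)%VS in
         let E2 := limg T in
         let isotropic_skew :=
           [/\ {in E1 &, forall e e', oE e e' = 0},
               {in E2 &, forall e e', oE e e' = 0}
             & forall e e' : subvs_of E1,
                 oE (T e) (vsval e') = - oE (vsval e) (T e')] in
         (totally_real g U <-> isotropic_skew) /\
         (isotropic_skew -> (E1 :&: E2 = 0)%VS))].
Proof.
move=> g p1 p2; have [hB oH12] := h12.
(* A nonzero [E] makes [Qtilde] a faithful copy of [sl H], so that admissible bases exist. *)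
have E_gt0 : (0 < \dim {:E})%N by rewrite dimE muln_gt0.
split=> [U | S T | U _ ndU T eqU].
- split=> [realU | [T [eqU [kT _] noW]]]; last first.
    by rewrite eqU; exact: no_stable_real_graph.
  have [T [eqU kT imT]] := real_subspace_graph hB realU.
  exists T; split=> // W W0; rewrite subv_cap => /andP[WS _].
  by apply: (real_graph_no_stable hB _ W0 WS); rewrite -eqU.
- exact/nondegenerate_limg/lker_graph_lfun.
rewrite eqU in ndU.
have trP := totally_real_graph hB oE oH12 T E_gt0.
by split; [rewrite -eqU in trP | exact: (isotropic_skew_disjoint hB oH12)].
Qed.
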